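(* Let $n\ge 2$ be an integer and let $G=\langle 2,n,2\rangle=\langle x,y : x^2=y^n=(xy)^2\rangle$ be the binary polyhedral group. Then the Pell-Narayana length of $G$ for the generating pair $(x,y)$ is $$\begin{cases}3n, & n\equiv 0\pmod 2,\\ 6n, & n\equiv 1\pmod 2.\end{cases}$$
   Context: For integers $\ell,m,n>1$, the binary polyhedral group $\langle \ell,m,n\rangle$ is defined by the presentation $\langle x,y : x^\ell=y^m=(xy)^n\rangle$ (equivalently $\langle x,y,z : x^\ell=y^m=z^n=xyz\rangle$). For a finite group $G$ generated by a pair $(x,y)$, the Pell-Narayana orbit of $G$ for $(x,y)$ is the sequence $(s_i)_{i\ge 0}$ in $G$ given by $s_0=x$, $s_1=y$, $s_2=y^2$, and $s_i=s_{i-3}(s_{i-1})^2$ for $i\ge 3$. The Pell-Narayana length of $G$ for $(x,y)$ is the period of this orbit, i.e. the least integer $k\ge 1$ such that $s_{i+k}=s_i$ for all $i\ge 0$. *)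

(* Defs.v *)
From HB Require Import structures.
From mathcomp Require Import all_boot.
From mathcomp Require Import boolp.

Set Implicit Arguments.
Unset Strict Implicit.
Unset Printing Implicit Defensive.

Local Open Scope group_scope.
Local Open Scope quotient_scope.

(* MathComp's [G \isog Grp (...)] only compares the finite group G with the
   finite quotients of a presentation; here the presented group itself is
   constructed, as group words modulo the congruence generated by the
   relations. *)

(* (a, false) stands for the generator a, and (a, true) for its inverse. *)
Definition word (X : choiceType) : Type := seq (X * bool).

Definition inv_letter (X : choiceType) (c : X * bool) : X * bool :=
  (c.1, ~~ c.2).

Definition inv_word (X : choiceType) (w : word X) : word X :=
  rev [seq inv_letter c | c <- w].

Section Presented.
Variables (X : choiceType) (rels : seq (word X * word X)).

Inductive pres_eq : word X -> word X -> Prop :=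
  | pres_rel u v of (u, v) \in rels : pres_eq u v
  | pres_cancel c : pres_eq [:: c; inv_letter c] [::]
  | pres_cat u u' v v' of pres_eq u u' & pres_eq v v' :
      pres_eq (u ++ v) (u' ++ v')
  | pres_refl u : pres_eq u u
  | pres_sym u v of pres_eq u v : pres_eq v u
  | pres_trans u v w of pres_eq u v & pres_eq v w : pres_eq u w.

(* Decided classically: the word problem is undecidable in general. *)
Definition pres_eqb (u v : word X) : bool := `[< pres_eq u v >].

Lemma pres_eqb_equiv : equiv_class_of pres_eqb.
Proof.
split=> [u|u v|v u w].
- by apply/asboolP; apply: pres_refl.
- by apply/asboolP/asboolP; apply: pres_sym.
- by move=> /asboolP uv /asboolP vw; apply/asboolP; apply: pres_trans uv vw.
Qed.

Canonical pres_equiv := EquivRelPack pres_eqb_equiv.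

Definition presented : Type := {eq_quot pres_equiv}.

HB.instance Definition _ := Choice.on presented.
HB.instance Definition _ := EqQuotient.on presented.

Definition class_of (w : word X) : presented := \pi_presented w.

Definition pres_one : presented := class_of [::].
Definition pres_mul (g h : presented) : presented :=
  class_of (repr g ++ repr h).
Definition pres_inv (g : presented) : presented :=
  class_of (inv_word (repr g)).

Lemma class_ofP u v : class_of u = class_of v <-> pres_eq u v.
Proof.
split=> [e|uv]; last by apply/eqmodP/asboolP.
by apply/asboolP; move/eqmodP: e.
Qed.

Lemma repr_class_of w : pres_eq (repr (class_of w)) w.
Proof. by apply/class_ofP; rewrite /class_of reprK. Qed.

Lemma class_of_repr g : class_of (repr g) = g.
Proof. exact: reprK. Qed.

Lemma class_of_cat u v : pres_mul (class_of u) (class_of v) = class_of (u ++ v).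
Proof. by apply/class_ofP; apply: pres_cat; apply: repr_class_of. Qed.

Lemma inv_letterK : involutive (@inv_letter X).
Proof. by case=> a b; rewrite /inv_letter /= negbK. Qed.

Lemma inv_wordK : involutive (@inv_word X).
Proof.
move=> w; rewrite /inv_word map_rev revK -map_comp -[RHS]map_id.
by apply: eq_map => c /=; rewrite inv_letterK.
Qed.

Lemma pres_cat_inv w : pres_eq (w ++ inv_word w) [::].
Proof.
elim: w => [|c w IHw]; first exact: pres_refl.
rewrite /inv_word map_cons rev_cons -cats1 -cat1s -catA (catA w).
apply: (@pres_trans _ ([:: c] ++ [:: inv_letter c])); last exact: pres_cancel.
apply: pres_cat; first exact: pres_refl.
by rewrite -[X in pres_eq _ X]cat0s; apply: pres_cat IHw (pres_refl _).
Qed.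

Lemma pres_mulA : associative pres_mul.
Proof.
by move=> g h k; rewrite -[g]class_of_repr -[h]class_of_repr -[k]class_of_repr
  !class_of_cat catA.
Qed.

Lemma pres_mul1g : left_id pres_one pres_mul.
Proof. by move=> g; rewrite -[g]class_of_repr class_of_cat. Qed.

Lemma pres_mulg1 : right_id pres_one pres_mul.
Proof. by move=> g; rewrite -[g]class_of_repr class_of_cat cats0. Qed.

Lemma pres_mulgV : right_inverse pres_one pres_inv pres_mul.
Proof.
move=> g; rewrite -{1}[g]class_of_repr class_of_cat.
by apply/class_ofP; apply: pres_cat_inv.
Qed.

Lemma pres_mulVg : left_inverse pres_one pres_inv pres_mul.
Proof.
move=> g; rewrite -{2}[g]class_of_repr class_of_cat.
by apply/class_ofP; rewrite -{2}[repr g]inv_wordK; apply: pres_cat_inv.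
Qed.

HB.instance Definition _ := isGroup.Build presented
  pres_mulA pres_mul1g pres_mulg1 pres_mulVg pres_mulgV.

Definition pres_gen (a : X) : presented := class_of [:: (a, false)].

End Presented.

(* The two generators are indexed by bool: false for x, true for y. *)
Definition letter_x : bool * bool := (false, false).
Definition letter_y : bool * bool := (true, false).

Definition word_pow (w : word bool) (k : nat) : word bool :=
  flatten (nseq k w).

(* x^l = y^m = (x y)^n *)
Definition polyhedral_rels (l m n : nat) : seq (word bool * word bool) :=
  [:: (word_pow [:: letter_x] l, word_pow [:: letter_y] m);
      (word_pow [:: letter_y] m, word_pow [:: letter_x; letter_y] n)].

Definition binary_polyhedral (l m n : nat) : groupType :=
  presented (polyhedral_rels l m n).

Definition bp_x (l m n : nat) : binary_polyhedral l m n :=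
  pres_gen (polyhedral_rels l m n) false.
Definition bp_y (l m n : nat) : binary_polyhedral l m n :=
  pres_gen (polyhedral_rels l m n) true.

Section UniversalProperty.
Variables l m n : nat.
Local Notation B := (binary_polyhedral l m n).
Local Notation x := (bp_x l m n).
Local Notation y := (bp_y l m n).

Lemma class_of_word_pow (w : word bool) k :
  class_of (polyhedral_rels l m n) (word_pow w k)
    = (class_of (polyhedral_rels l m n) w : B) ^+ k.
Proof.
elim: k => [|k IHk]; first by [].
by rewrite expgS -IHk; symmetry; apply: class_of_cat.
Qed.

Lemma bp_relations : x ^+ l = y ^+ m /\ y ^+ m = (x * y) ^+ n.
Proof.
have -> : x * y = class_of (polyhedral_rels l m n) [:: letter_x; letter_y] :> B.
  exact: class_of_cat.
by rewrite /bp_x /bp_y /pres_gen -!class_of_word_pow; split; apply/class_ofP;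
  apply: pres_rel; rewrite !inE eqxx ?orbT.
Qed.

Lemma bp_lift (H : groupType) (a b : H) :
  a ^+ l = b ^+ m -> b ^+ m = (a * b) ^+ n ->
  exists f : B -> H, [/\ {morph f : g h / g * h}, f x = a & f y = b].
Proof.
move=> ab bab.
pose ev1 (c : bool * bool) : H :=
  let g := if c.1 then b else a in if c.2 then g^-1 else g.
pose ev (w : word bool) : H := foldr (fun c g => ev1 c * g) 1 w.
have ev_cat u v : ev (u ++ v) = ev u * ev v.
  by elim: u => [|c u IHu] /=; rewrite ?mul1g // IHu mulgA.
have ev_pow w k : ev (word_pow w k) = ev w ^+ k.
  by elim: k => [|k IHk] //; rewrite expgS -IHk -ev_cat.
have evE u v : pres_eq (polyhedral_rels l m n) u v -> ev u = ev v.
  elim=> {u v} [u v|[[] []]|u u' v v' _ + _|//|u v _ ->//|u v w _ -> _ -> //].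
  - rewrite !inE => /orP[]/eqP[-> ->]; rewrite !ev_pow /= /ev1 /= !mulg1 //.
  - by rewrite /= /ev1 /= mulg1 mulVg.
  - by rewrite /= /ev1 /= mulg1 mulgV.
  - by rewrite /= /ev1 /= mulg1 mulVg.
  - by rewrite /= /ev1 /= mulg1 mulgV.
  - by rewrite !ev_cat => -> ->.
exists (fun g : B => ev (repr (g : presented (polyhedral_rels l m n)))).
split=> [g h||].
- by rewrite (evE _ _ (repr_class_of _ _)) ev_cat.
- by rewrite (evE _ _ (repr_class_of _ _)) /= /ev1 /= mulg1.
- by rewrite (evE _ _ (repr_class_of _ _)) /= /ev1 /= mulg1.
Qed.

End UniversalProperty.

Fixpoint pell_narayana_orbit (G : groupType) (x y : G) (i : nat) : G :=
  match i with
  | 0 => x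
  | 1 => y
  | 2 => y ^+ 2
  | (j.+2 as k).+1 =>
      pell_narayana_orbit x y j * pell_narayana_orbit x y k ^+ 2
  end.

Definition is_orbit_period (G : groupType) (x y : G) (k : nat) : Prop :=
  0 < k /\ forall i, pell_narayana_orbit x y (i + k) = pell_narayana_orbit x y i.

Definition is_pell_narayana_length (G : groupType) (x y : G) (k : nat) : Prop :=
  is_orbit_period x y k /\ forall k', is_orbit_period x y k' -> k <= k'.

(* Main.v *)
Require Import Defs.
From mathcomp Require Import all_boot.
From HB Require Import structures.
From mathcomp Require Import all_algebra zify.

Set Implicit Arguments.
Unset Strict Implicit.
Unset Printing Implicit Defensive.

(** In G the element z = x^2 = y^n is central with z^2 = 1 and x inverts y, so
    (x y^k)^2 = z for every k.  Hence the orbit is given in closed form by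
    s_(3i) = x y^(2i(i+1)), s_(3i+1) = y z^i and s_(3i+2) = y^(2(i+1)).  It is
    periodic as soon as y^(2i) = z^i = 1.  Conversely, G maps onto a concrete
    dicyclic group of order 4n, in which y has order 2n and x is not a power
    of y, so a period is necessarily 3i with i divisible by both n and 2. *)

(** * Consequences of the relations in an arbitrary group *)

Section DicyclicRelations.
Local Open Scope group_scope.
Variables (G : groupType) (n : nat) (x y : G).
Hypotheses (x2E : x ^+ 2 = y ^+ n) (xy2E : y ^+ n = (x * y) ^+ 2).

(** Multiplied by x on the left and y on the right, this is (xy)^2 = x^2. *)
Lemma dicyclic_mul_yx : y * x = x * y^-1.
Proof.
apply: (mulIg y); apply: (mulgI x); rewrite mulgVK.
by rewrite -[RHS]expg2 x2E xy2E expg2 !mulgA.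
Qed.

Lemma dicyclic_mul_expyx k : y ^+ k * x = x * y ^- k.
Proof.
elim: k => [|k IHk]; first by rewrite !expg0 invg1 mul1g mulg1.
by rewrite [in LHS]expgSr -mulgA dicyclic_mul_yx mulgA IHk expgS invgM mulgA.
Qed.

(** As x^2, the element y^n commutes with x, yet x also inverts it; so it is its own inverse. *)
Lemma dicyclic_expy2n : y ^+ (2 * n) = 1.
Proof.
have e : y ^+ n * x = x * y ^+ n by rewrite -x2E -expgSr -expgS.
rewrite dicyclic_mul_expyx in e; move/mulgI: e => e.
by rewrite mulSn mul1n expgnDr -{1}e mulVg.
Qed.

Lemma dicyclic_sqr_xy k : (x * y ^+ k) ^+ 2 = y ^+ n.
Proof.
by rewrite expg2 mulgA -[x * _ * x]mulgA dicyclic_mul_expyx mulgA mulgVK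
  -x2E expg2.
Qed.

Lemma pell_narayana_orbitS3 i :
  pell_narayana_orbit x y i.+3 =
  pell_narayana_orbit x y i * pell_narayana_orbit x y i.+2 ^+ 2.
Proof. by []. Qed.

Lemma dicyclic_orbitE i :
  [/\ pell_narayana_orbit x y (3 * i) = x * y ^+ (2 * (i * i.+1)),
      pell_narayana_orbit x y (3 * i).+1 = y ^+ (n * i).+1 &
      pell_narayana_orbit x y (3 * i).+2 = y ^+ (2 * i.+1)].
Proof.
elim: i => [|i [IH0 IH1 IH2]]; first by rewrite !muln0 mulg1.
have -> : (3 * i.+1 = (3 * i).+3)%N by lia.
have e0 : pell_narayana_orbit x y (3 * i).+3 = x * y ^+ (2 * (i.+1 * i.+2)).
  rewrite pell_narayana_orbitS3 IH0 IH2 -expgnA -mulgA -expgnDr.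
  by congr (x * y ^+ _); lia.
have e1 : pell_narayana_orbit x y (3 * i).+4 = y ^+ (n * i.+1).+1.
  rewrite pell_narayana_orbitS3 IH1 e0 dicyclic_sqr_xy -expgnDr.
  by congr (y ^+ _); lia.
split=> //; rewrite pell_narayana_orbitS3 IH2 e1 -expgnA -expgnDr.
(* The summand 2n(i+1) is isolated because y^(2n) = 1 removes it. *)
have -> : (2 * i.+1 + (n * i.+1).+1 * 2 = 2 * i.+2 + 2 * n * i.+1)%N by lia.
by rewrite expgnDr (expgnA y (2 * n)) dicyclic_expy2n expg1n mulg1.
Qed.

(** In the three residue classes modulo 3 the exponent of y grows by 2i(2q+i+1), ni and 2i. The
    first and last are multiples of 2n because n divides i, the second because i is even. *)
Lemma dicyclic_orbit_shift i :
  n %| i -> 2 %| i ->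
  forall j, pell_narayana_orbit x y (j + 3 * i) = pell_narayana_orbit x y j.
Proof.
move=> ni evi j.
have expy a b : (2 * n %| b)%N -> y ^+ (a + b) = y ^+ a.
  by case/dvdnP=> c ->; rewrite expgnDr mulnC expgnA dicyclic_expy2n expg1n mulg1.
have [a0 a1 a2] := dicyclic_orbitE (j %/ 3).
have [b0 b1 b2] := dicyclic_orbitE (j %/ 3 + i).
have jE := divn_eq j 3; rewrite mulnC in jE.
have := ltn_pmod j (isT : 0 < 3); move: (j %/ 3) (j %% 3) jE a0 a1 a2 b0 b1 b2.
move=> q r -> a0 a1 a2 b0 b1 b2.
have -> : (3 * q + r + 3 * i = 3 * (q + i) + r)%N by lia.
case: r => [|[|[|//]]] _.
- rewrite !addn0 a0 b0; congr (x * _).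
  have -> : (2 * ((q + i) * (q + i).+1) =
    2 * (q * q.+1) + 2 * (i * (2 * q + i + 1)))%N by lia.
  by apply: expy; rewrite dvdn_pmul2l // dvdn_mulr.
- rewrite !addn1 a1 b1 mulnDr -addSn expy //.
  by rewrite mulnC dvdn_mul.
- rewrite !addn2 a2 b2 -addSn mulnDr expy //.
  by rewrite dvdn_pmul2l.
Qed.

Lemma dicyclic_period_dvd k :
    (forall j, y ^+ j = 1 -> (2 * n %| j)%N) -> (forall j, y ^+ j <> x) ->
    0 < n -> is_orbit_period x y k ->
  exists i, [/\ k = (3 * i)%N, n %| i & 2 %| i].
Proof.
move=> ordy xNy n0 [_ per].
have := per 0%N; have := per 1%N; have := per 2; rewrite add0n add1n add2n.
have [b0 b1 b2] := dicyclic_orbitE (k %/ 3).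
have kE := divn_eq k 3; rewrite mulnC in kE.
have := ltn_pmod k (isT : 0 < 3); move: (k %/ 3) (k %% 3) kE b0 b1 b2.
move=> i r -> b0 b1 b2.
case: r => [|[|[|//]]] _; rewrite ?addn0 ?addn1 ?addn2.
(* For k = 3i, index 2 yields y^(2i) = 1 and index 1 yields y^(ni) = 1. *)
- rewrite b1 b2 /= => e2 e1 _; exists i; split=> //.
  + rewrite -(@dvdn_pmul2l 2) //; apply: ordy; apply: (mulgI (y ^+ 2)).
    by rewrite -expgnDr mulg1 -e2; congr (y ^+ _); lia.
  + rewrite -(@dvdn_pmul2l n) // mulnC; apply: ordy; apply: (mulgI y).
    by rewrite -expgS mulg1.
(* For k not divisible by 3, s_k is a power of y, but s_k = s_0 = x. *)
- by rewrite b1 /= => _ _ /xNy.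
- by rewrite b2 /= => _ _ /xNy.
Qed.

End DicyclicRelations.

(** * A concrete model: the dicyclic group of order 4n for n > 0 *)

Section DicyclicGroup.
Import GRing.Theory.
Local Open Scope ring_scope.
Variable n : nat.

(* The pair (e, a) stands for x^e y^a. *)
Definition dicyclic : Type := (bool * 'Z_(2 * n))%type.

HB.instance Definition _ := Choice.on dicyclic.

Definition dicyclic_one : dicyclic := (false, 0).
(** Moving y^a past x flips the sign of a; the final term is the carry x^2 = y^n. *)
Definition dicyclic_mul (g h : dicyclic) : dicyclic :=
  (g.1 (+) h.1,
   (if h.1 then - g.2 else g.2) + h.2 + (if g.1 && h.1 then n%:R else 0)).
Definition dicyclic_inv (g : dicyclic) : dicyclic :=
  (g.1, if g.1 then g.2 + n%:R else - g.2).

Lemma dicyclic_natDn : n%:R + n%:R = 0 :> 'Z_(2 * n).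
Proof.
rewrite -natrD addnn -mul2n.
(* ['Z_0] is by convention the ring with two elements, so reduction modulo 2n is available only for
   n > 0. *)
case: n => [|m]; first by rewrite muln0.
by apply/val_inj; rewrite /= val_Zp_nat ?modnn //; lia.
Qed.

(** Associativity rests on this: the carry y^n is unchanged by the inversion that x induces. *)
Lemma dicyclic_natNn : - n%:R = n%:R :> 'Z_(2 * n).
Proof. by apply/eqP; rewrite eq_sym -addr_eq0 dicyclic_natDn. Qed.

Lemma dicyclic_mulA : associative dicyclic_mul.
Proof.
move=> [[] a] [[] b] [[] c]; rewrite /dicyclic_mul /=; congr pair;
  rewrite ?addr0 ?opprD ?opprK ?dicyclic_natNn ?addrA //;
  by rewrite [LHS]addrAC.
Qed.

Lemma dicyclic_mul1g : left_id dicyclic_one dicyclic_mul.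
Proof.
by move=> [[] a]; rewrite /dicyclic_mul /= ?oppr0 add0r addr0.
Qed.

Lemma dicyclic_mulg1 : right_id dicyclic_one dicyclic_mul.
Proof. by move=> [[] a]; rewrite /dicyclic_mul /= !addr0. Qed.

Lemma dicyclic_mulVg : left_inverse dicyclic_one dicyclic_inv dicyclic_mul.
Proof.
move=> [[] a]; rewrite /dicyclic_mul /dicyclic_one /=; congr pair.
- by rewrite opprD addrAC subrK addNr.
- by rewrite addNr addr0.
Qed.

Lemma dicyclic_mulgV : right_inverse dicyclic_one dicyclic_inv dicyclic_mul.
Proof.
move=> [[] a]; rewrite /dicyclic_mul /dicyclic_one /=; congr pair.
- by rewrite addrA addNr add0r dicyclic_natDn.
- by rewrite subrr addr0.
Qed.

HB.instance Definition _ := isGroup.Build dicyclic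
  dicyclic_mulA dicyclic_mul1g dicyclic_mulg1 dicyclic_mulVg dicyclic_mulgV.

Definition dicyclic_x : dicyclic := (true, 0).
Definition dicyclic_y : dicyclic := (false, 1).

Lemma dicyclic_expy k : (dicyclic_y ^+ k)%g = (false, k%:R) :> dicyclic.
Proof.
elim: k => [|k IHk] //; rewrite expgS IHk.
by rewrite -[LHS]/(dicyclic_mul _ _) /dicyclic_mul /= addr0 -natr1 addrC.
Qed.

Lemma dicyclic_x2E : (dicyclic_x ^+ 2 = dicyclic_y ^+ n)%g.
Proof.
rewrite dicyclic_expy expg2 -[LHS]/(dicyclic_mul _ _) /dicyclic_mul /=.
by rewrite oppr0 !add0r.
Qed.

Lemma dicyclic_xy2E : (dicyclic_y ^+ n = (dicyclic_x * dicyclic_y) ^+ 2)%g.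
Proof.
rewrite dicyclic_expy expg2.
rewrite -[RHS]/(dicyclic_mul (dicyclic_mul _ _) (dicyclic_mul _ _)).
rewrite /dicyclic_mul /=.
by rewrite !add0r addr0 addNr add0r.
Qed.

Lemma dicyclic_expy_eq1 k :
  (0 < n)%N -> (dicyclic_y ^+ k)%g = 1%g -> (2 * n %| k)%N.
Proof.
move=> n0; rewrite dicyclic_expy => -[/(congr1 val)].
by rewrite /= val_Zp_nat; [move/eqP | lia].
Qed.

Lemma dicyclic_expy_neqx k : (dicyclic_y ^+ k)%g <> dicyclic_x.
Proof. by rewrite dicyclic_expy. Qed.

End DicyclicGroup.

(** * Transfer from the model to the presented group *)

Section BinaryPolyhedral2n2.
Local Open Scope group_scope.
Variables (n : nat).
Local Notation x := (bp_x 2 n 2).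
Local Notation y := (bp_y 2 n 2).

(** The universal property supplies f. Through it, facts about powers of y in the model rule out
    further collapse in the presented group. *)
Lemma bp_to_dicyclic :
  exists f : binary_polyhedral 2 n 2 -> dicyclic n,
    [/\ f 1 = 1, f x = dicyclic_x n & forall k, f (y ^+ k) = dicyclic_y n ^+ k].
Proof.
have [f [fM fx fy]] := bp_lift (dicyclic_x2E n) (dicyclic_xy2E n).
have f1 : f 1 = 1 by apply: (mulgI (f 1)); rewrite -fM !mulg1.
by exists f; split=> //; elim=> [|k IHk] //; rewrite !expgS fM fy IHk.
Qed.

Lemma bp_expy_eq1 k : 0 < n -> y ^+ k = 1 -> (2 * n %| k)%N.
Proof.
have [f [f1 _ fy]] := bp_to_dicyclic => n0 yk.
by apply: dicyclic_expy_eq1; rewrite // -fy yk.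
Qed.

Lemma bp_expy_neqx k : y ^+ k <> x.
Proof.
have [f [_ fx fy]] := bp_to_dicyclic => /(congr1 f).
by rewrite fx fy; apply: dicyclic_expy_neqx.
Qed.

End BinaryPolyhedral2n2.

Theorem theorem23 (n : nat) (hn : 2 <= n) :
  is_pell_narayana_length (bp_x 2 n 2) (bp_y 2 n 2)
    (if odd n then 6 * n else 3 * n).
Proof.
have n0 : 0 < n by lia.
have [x2E xy2E] := bp_relations 2 n 2.
(* Periods are the numbers 3i with i > 0 divisible by n and by 2, so the least one comes from the
   lcm. *)
have -> : (if odd n then 6 * n else 3 * n) = 3 * lcmn n 2.
  case: ifP => [on|/negbT on].
    by rewrite /lcmn (eqP (_ : coprime n 2)) ?coprimen2 // divn1; lia.
  by rewrite (lcmn_idPl _) // dvdn2.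
split; first split.
- by rewrite muln_gt0 lcmn_gt0 n0.
- exact: (dicyclic_orbit_shift x2E xy2E (dvdn_lcml _ _) (dvdn_lcmr _ _)).
move=> k per; have k0 := per.1.
have ordy j := @bp_expy_eq1 n j n0.
have [i [kE ni evi]] :=
  dicyclic_period_dvd x2E xy2E ordy (@bp_expy_neqx n) n0 per.
(* Positivity of k gives i > 0, without which divisibility would not bound the lcm. *)
rewrite kE leq_pmul2l //; apply: dvdn_leq; first by lia.
by rewrite dvdn_lcm ni.
Qed.
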